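(* Let $r,p,q$ be integers, $r\neq0$, such that the quadratic equation $rx^2+px=q$ has real irrational roots, and let $\Delta=p^2+4rq$. Let $$\frac{-p+\sqrt{\Delta}}{2r}=[a_0;a_1,\ldots,a_m,\overline{a_{m+1},\ldots,a_{m+T}}]$$ be the (eventually periodic) regular continued fraction, where the bar denotes the repeating block and $T=T(r,p,q)$ is the length of the period. Then $$\sum_{i=1}^{T}a_{m+i}\le f(\Delta/4),$$ where $$f(Q)=2D(Q)+\tau(Q)\quad\text{if } Q \text{ is an integer},\qquad f(Q)=2\sum_{\substack{i\in\{1,3,5,\ldots\}\\ i^2<4Q}}\tau\!\left(Q-\frac{i^2}{4}\right)\quad\text{otherwise}.$$ Moreover, if the period length $T$ is odd, then $$\sum_{i=1}^{T}a_{m+i}\le \tfrac12 f(\Delta/4).$$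
   Context: $\tau(n)$ is the number of positive divisors of the positive integer $n$. For a positive integer $Q$ (not a perfect square), $D(Q)=\sum_{u=1}^{\lfloor\sqrt{Q}\rfloor}\tau(Q-u^2)$. The period length $T$ is the length of the shortest repeating block of the continued fraction, and $m$ is the index after which the expansion is periodic (the sum over one period does not depend on which admissible $m$ is used). *)

(* Defs.v *)
From mathcomp Require Import all_boot all_order all_algebra.
From mathcomp Require Import all_classical all_reals.

Set Implicit Arguments.
Unset Strict Implicit.
Unset Printing Implicit Defensive.

Import Order.TTheory GRing.Theory Num.Theory.
Local Open Scope ring_scope.

(* Complete quotients of the regular continued fraction of x. The algorithm
   never stops when x is irrational; on rationals it is completed by the
   convention 0^-1 = 0. *)
Fixpoint cf_complete (R : realType) (x : R) (n : nat) : R :=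
  if n is n'.+1 then
    let y := cf_complete x n' in (y - (Num.floor y)%:~R)^-1
  else x.

Definition cf_quotient (R : realType) (x : R) (n : nat) : int :=
  Num.floor (cf_complete x n).

Definition periodic_after (a : nat -> int) (m T : nat) : Prop :=
  (0 < T)%N /\ forall n, (m < n)%N -> a (n + T)%N = a n.

Definition is_period_length (a : nat -> int) (T : nat) : Prop :=
  (exists m, periodic_after a m T) /\
  forall m' T', periodic_after a m' T' -> (T <= T')%N.

Definition has_irrational_roots (R : realType) (r p q : int) : Prop :=
  let is_root (x : R) := r%:~R * x ^+ 2 + p%:~R * x = q%:~R in
  (exists x, is_root x) /\ (forall x, is_root x -> irrational x).

Definition discr (r p q : int) : int := p ^+ 2 + 4 * r * q.

Definition tau (n : nat) : nat := size (divisors n).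

Definition D (Q : nat) : nat :=
  (\sum_(1 <= u < (Nat.sqrt Q).+1) tau (Q - u ^ 2))%N.

(* Num.truncn is the identity on the nonnegative integers; in the second branch
   all Q - i^2/4 are positive integers when Q = n/4 with n = 1 mod 4, which is
   the case for a discriminant n not divisible by 4. The upper bound on i is not
   a restriction, as i <= i^2 < 4 Q. *)
Definition f (Q : rat) : nat :=
  if Q \is a Num.int then
    (2 * D (Num.truncn Q) + tau (Num.truncn Q))%N
  else
    (2 * \sum_(0 <= i < (Num.truncn (4 * Q)%R).+1 |
                 odd i && (i%:R ^+ 2 < 4 * Q :> rat)%R)
           tau (Num.truncn (Q - i%:R ^+ 2 / 4)%R))%N.

(* Main.v *)
(* A positive irrational x with negative conjugate is the positive root of a
   unique equation A x^2 + B x = C with A, C > 0 and B^2 + 4AC = Delta, and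
   f (Delta/4) counts the triples (A, B, C). The complete quotients y_n of the
   given root eventually have negative conjugates. Then, over one period, the
   numbers y_n - j with 0 <= j < a_n are pairwise distinct (an equality would
   give a shorter period), exceed 1, and have negative conjugates; their
   inverses are as many further numbers of the same kind, all less than 1.
   Hence twice the sum of the a_n is at most f (Delta/4), whatever the parity
   of the period. *)

From Stdlib Require PeanoNat.
Require Import Defs.
From mathcomp Require Import all_boot all_order all_algebra.
From mathcomp Require Import all_classical all_reals.
From mathcomp Require Import zify ring lra.

Set Implicit Arguments.
Unset Strict Implicit.
Unset Printing Implicit Defensive.

Import Order.TTheory GRing.Theory Num.Theory.
Local Open Scope ring_scope.

(** * Quadratic equations under translation and inversion of the root *)

(* The triple (A, B, C) stands for the equation A x^2 + B x = C. *)
Definition qform : Type := (int * int * int)%type.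

Definition qform_disc (g : qform) : int :=
  g.1.2 ^+ 2 + 4 * g.1.1 * g.2.

(** Here [s] is either square root of the discriminant, so [s] and [- s] give the two conjugate
    roots. *)
Definition qform_root (R : realType) (s : R) (g : qform) : R :=
  (s - g.1.2%:~R) / (2 * g.1.1%:~R).

(** The substitution of x + k for x, which lowers both roots by [k]. *)
Definition qform_shift (k : int) (g : qform) : qform :=
  (g.1.1, g.1.2 + 2 * k * g.1.1, g.2 - k * g.1.2 - k ^+ 2 * g.1.1).

(** The substitution of 1/x for x; the signs are chosen so that [s] still selects the inverse of the
    root it selected before. *)
Definition qform_inv (g : qform) : qform := (g.2, - g.1.2, g.1.1).

Definition qform_pos (g : qform) : bool := (0 < g.1.1) && (0 < g.2).

Lemma qform_disc_shift k g : qform_disc (qform_shift k g) = qform_disc g.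
Proof. case: g => [[A B] C]; rewrite /qform_disc /=; ring. Qed.

Lemma qform_disc_inv g : qform_disc (qform_inv g) = qform_disc g.
Proof. case: g => [[A B] C]; rewrite /qform_disc /=; ring. Qed.

Lemma qform_inv_pos g : qform_pos (qform_inv g) = qform_pos g.
Proof. exact: andbC. Qed.

Lemma qform_invK : involutive qform_inv.
Proof. by case=> [[A B] C]; rewrite /qform_inv /= opprK. Qed.

(** * Conjugate roots for a nonsquare discriminant *)

Section NonsquareDiscriminant.

Variables (R : realType) (d : int).
Hypothesis d_nonsquare : forall t : int, t ^+ 2 <> d.

Lemma qform_lead_neq0 g : qform_disc g = d -> g.1.1 != 0.
Proof.
move=> dg; apply/eqP => A0; apply: (d_nonsquare (t := g.1.2)).
by rewrite -dg /qform_disc A0; ring.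
Qed.

Lemma qform_const_neq0 g : qform_disc g = d -> g.2 != 0.
Proof. by rewrite -qform_disc_inv => /qform_lead_neq0. Qed.

Lemma qform_root_shift (s : R) k g : qform_disc g = d ->
  qform_root s (qform_shift k g) = qform_root s g - k%:~R.
Proof.
case: g => [[A B] C] /qform_lead_neq0 /= A0; rewrite /qform_root /=.
have A0' : A%:~R != 0 :> R by rewrite intr_eq0.
rewrite rmorphD !rmorphM /=; field.
exact: A0'.
Qed.

Lemma root_neq_int (s : R) : s ^+ 2 = d%:~R -> forall k : int, s != k%:~R.
Proof.
move=> s2 k; apply/eqP => sk; apply: (d_nonsquare (t := k)).
by apply/eqP; rewrite -(eqr_int R) rmorphXn /= -sk s2.
Qed.

Lemma qform_root_neq_int (s : R) g : s ^+ 2 = d%:~R -> qform_disc g = d ->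
  forall k : int, qform_root s g != k%:~R.
Proof.
move=> s2 dg k; rewrite -subr_eq0 -qform_root_shift //.
have A0 : (2 * (qform_shift k g).1.1)%:~R != 0 :> R.
  by rewrite intr_eq0 mulf_neq0 // (qform_lead_neq0 dg).
rewrite /qform_root mulf_neq0 //; first by rewrite subr_eq0 root_neq_int.
by rewrite invr_eq0; move: A0; rewrite rmorphM.
Qed.

(** The reason is (s - B)(s + B) = 4AC; nonsquareness keeps A, C and s - B away from 0. *)
Lemma qform_root_inv (s : R) g : s ^+ 2 = d%:~R -> qform_disc g = d ->
  qform_root s (qform_inv g) = (qform_root s g)^-1.
Proof.
move=> s2 dg; have A0 := qform_lead_neq0 dg; have C0 := qform_const_neq0 dg.
have := root_neq_int s2 g.1.2.
move: s2; rewrite -dg {dg}.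
case: g A0 C0 => [[A B] C] /= A0 C0; rewrite /qform_root /qform_disc /= => s2.
have A0' : A%:~R != 0 :> R by rewrite intr_eq0.
have C0' : C%:~R != 0 :> R by rewrite intr_eq0.
rewrite -subr_eq0 => sB; move: s2; rewrite rmorphD rmorphXn !rmorphM /= => s2.
rewrite rmorphN /= invf_div; apply/eqP.
rewrite eqr_div // ?mulf_neq0 ?pnatr_eq0 //.
apply/eqP; move: s2; set a := A%:~R; set b := B%:~R.
by set c := C%:~R => s2; ring: s2.
Qed.

(** Vieta's formula for the product of the roots. *)
Lemma qform_root_mul (s : R) g : s ^+ 2 = d%:~R -> qform_disc g = d ->
  qform_root s g * qform_root (- s) g = - (g.2%:~R / g.1.1%:~R).
Proof.
move=> s2 dg; have A0 := qform_lead_neq0 dg.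
move: s2; rewrite -dg {dg}.
case: g A0 => [[A B] C] /= A0; rewrite /qform_root /qform_disc /=.
have A0' : A%:~R != 0 :> R by rewrite intr_eq0.
rewrite rmorphD rmorphXn !rmorphM /= => s2.
apply: (@mulIf _ (4 * A%:~R ^+ 2)); first by rewrite mulf_neq0 ?pnatr_eq0 ?sqrf_eq0.
transitivity (B%:~R ^+ 2 - s ^+ 2); first by field.
by rewrite s2; field.
Qed.

(** The difference s/A of the roots gives the sign of A, then their product -C/A gives that of C. *)
Lemma qform_posP (s : R) g : 0 < s -> s ^+ 2 = d%:~R -> qform_disc g = d ->
  0 < qform_root s g -> qform_root (- s) g < 0 -> qform_pos g.
Proof.
move=> s0 s2 dg y0 z0; have A0 := qform_lead_neq0 dg.
have A0' : g.1.1%:~R != 0 :> R by rewrite intr_eq0.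
have Agt0 : 0 < g.1.1%:~R :> R.
  have : 0 < qform_root s g - qform_root (- s) g by lra.
  have -> : qform_root s g - qform_root (- s) g = s / g.1.1%:~R.
    by rewrite /qform_root; field.
  by rewrite pmulr_rgt0 // invr_gt0.
rewrite /qform_pos -!(ltr0z R) Agt0 /=.
have : qform_root s g * qform_root (- s) g < 0 by rewrite pmulr_rlt0.
by rewrite qform_root_mul // oppr_lt0 pmulr_lgt0 // invr_gt0.
Qed.

End NonsquareDiscriminant.

(** * Counting positive triples by divisor sums *)

(** Since n = B^2 + 4AC, the entry A divides (n - B^2)/4 and fixes C as the quotient. For every B
    that occurs, the truncated subtraction and division are exact. *)
Lemma size_qform_pos_le (n : nat) (bs : seq int) (L : seq qform) : uniq L ->
  {in L, forall g, [/\ qform_pos g, qform_disc g = n%:Z & g.1.2 \in bs]} ->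
  (size L <= \sum_(b <- bs) tau ((n - `|b| ^ 2) %/ 4))%N.
Proof.
move=> uL HL.
pose c (b : int) := ((n - `|b| ^ 2) %/ 4)%N.
pose F := [seq (Posz k, b, Posz (c b %/ k)) | b <- bs, k <- divisors (c b)].
have -> : (\sum_(b <- bs) tau (c b))%N = size F.
  by rewrite size_allpairs_dep sumnE big_map.
apply: uniq_leq_size => // -[[A B] C] /HL[/andP[/= A0 C0]].
rewrite /qform_disc /= => dn Bbs.
case: A A0 dn => // A A0; case: C C0 => // C C0 dn.
have cE : c B = (A * C)%N.
  have : n = (`|B| ^ 2 + A * C * 4)%N.
    apply/eqP; rewrite -eqz_nat -dn -abszX PoszD gez0_abs ?sqr_ge0 // !PoszM.
    by apply/eqP; ring.
  by rewrite /c => ->; rewrite addKn mulnK.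
apply/allpairsPdep; exists B, A; split=> //; rewrite cE.
- by rewrite -dvdn_divisors ?dvdn_mulr // muln_gt0; apply/andP.
- by rewrite mulKn.
Qed.

Lemma rat_div4_int (k : int) :
  (k%:~R / 4 :> rat) \is a Num.int -> exists j : int, k = 4 * j.
Proof.
move=> /intrP[j /(congr1 (fun x : rat => x * 4))]; rewrite mulfVK // => kj.
by exists j; apply/eqP; rewrite -(eqr_int rat) rmorphM /= kj mulrC.
Qed.

(** B has the parity of n, so the two branches of [f] list the possible even or odd B. The form p^2
    + 4rq ensures that n is 0 or 1 modulo 4. *)
Lemma size_qform_pos_le_f (n : nat) (L : seq qform) : uniq L ->
  {in L, forall g, qform_pos g /\ qform_disc g = n%:Z} ->
  (exists p r q : int, n%:Z = p ^+ 2 + 4 * r * q) ->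
  (size L <= f (n%:Z%:~R / 4))%N.
Proof.
move=> uL HL [p [r [q npq]]]; rewrite /f.
have [nint|nint] := boolP (_ \is a Num.int).
  have [k nk] := rat_div4_int nint.
  case: k nk => k nk; last by lia.
  have {nk} nk : n = (4 * k)%N by lia.
  have -> : n%:~R / 4 = k%:R :> rat.
    by rewrite nk PoszM rmorphM /= mulrC mulKf.
  rewrite natrK.
  set us := index_iota 1 (Nat.sqrt k).+1.
  (* B = 0 contributes tau(Q); B = 2u and B = -2u contribute D(Q) each. *)
  pose bs : seq int := 0 :: [seq 2 * u%:Z | u <- us] ++ [seq - (2 * u%:Z) | u <- us].
  apply: leq_trans (size_qform_pos_le (n := n) (bs := bs) uL _) _.
    move=> g /HL[gpos dg]; split=> //.
    case: g gpos dg => [[A B] C] /andP[/= A0 C0]; rewrite /qform_disc /= => dn.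
    (* B^2 = n - 4AC is divisible by 4. *)
    have [b Bb] : exists b, B = 2 * b.
      exists (B %/ 2)%Z.
      have := divz_eq B 2; have := ltz_mod B (isT : (2 : int) != 0).
      have := modz_ge0 B (isT : (2 : int) != 0).
      move: (B %/ 2)%Z (B %% 2)%Z => u v *; nia.
    have bk : (`|b| * `|b| <= k)%N by nia.
    rewrite /bs inE mem_cat.
    have [->|b0] := eqVneq B 0; first by [].
    have bus : `|b|%N \in us.
      rewrite mem_index_iota ltnS; apply/andP; split; first by lia.
      by apply/ssrnat.leP/PeanoNat.Nat.sqrt_le_square/ssrnat.leP.
    rewrite /=; case: (leP 0 b) => b1; [apply/orP; left|apply/orP; right];
      apply/mapP; exists `|b|%N => //; lia.
  rewrite big_cons big_cat !big_map.
  have tE (b : int) (u : nat) : `|b|%N = (2 * u)%N ->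
      tau ((n - `|b| ^ 2) %/ 4) = tau (k - u ^ 2).
    by move=> ->; rewrite nk expnMn -mulnBr mulKn.
  rewrite (tE 0 0%N) // subn0.
  rewrite (eq_bigr (fun u => tau (k - u ^ 2))); last by move=> u _; apply: tE; lia.
  rewrite [X in (_ + (_ + X))%N](eq_bigr (fun u => tau (k - u ^ 2))); last first.
    by move=> u _; apply: tE; lia.
  rewrite /D -/us mul2n -addnn addnC.
  exact: leqnn.
have n4 : 4 * (n%:~R / 4) = n%:R :> rat by rewrite mulrC mulfVK // -pmulrn.
rewrite n4 natrK.
have n1 : (n %% 4 = 1)%N.
  have n0 : (n %% 4 <> 0)%N.
    move=> n0; case/negP: nint; apply/intrP; exists (n %/ 4)%N%:Z.
    by rewrite {1}(divn_eq n 4) n0 addn0 PoszM rmorphM /= mulfK.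
  have := divz_eq p 2; have := ltz_mod p (isT : (2 : int) != 0).
  have := modz_ge0 p (isT : (2 : int) != 0).
  move: (p %/ 2)%Z (p %% 2)%Z => u v v0 v2 pE.
  have nE : n%:Z = 4 * (u ^+ 2 + u * v + r * q) + v ^+ 2 by rewrite npq pE; ring.
  have [vE|vE] : v = 0 \/ v = 1 by lia.
    by rewrite vE in nE; lia.
  by rewrite vE in nE; lia.
set us := [seq i <- index_iota 0 n.+1 | odd i && (i%:R ^+ 2 < n%:R :> rat)].
pose bs : seq int := [seq u%:Z | u <- us] ++ [seq - u%:Z | u <- us].
apply: leq_trans (size_qform_pos_le (n := n) (bs := bs) uL _) _.
  move=> g /HL[gpos dg]; split=> //.
  case: g gpos dg => [[A B] C] /andP[/= A0 C0]; rewrite /qform_disc /= => dn.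
  have Bus : `|B|%N \in us.
    rewrite mem_filter mem_index_iota -natrX ltr_nat.
    have BE : n = (`|B| ^ 2 + 4 * (`|A| * `|C|))%N.
      apply/eqP; rewrite -eqz_nat -dn -abszX PoszD gez0_abs ?sqr_ge0 // !PoszM.
      by rewrite !gtz0_abs // mulrA.
    have AC0 : (0 < `|A| * `|C|)%N by rewrite muln_gt0 !absz_gt0 !gt_eqF.
    have oB : odd `|B|.
      have /(congr1 odd) : (n %% 4 = 1)%N by [].
      by rewrite odd_mod // BE oddD oddX oddM addbF.
    rewrite oB /=; apply/andP; split; first by lia.
    rewrite ltnS; apply: (@leq_trans (`|B| ^ 2)); last by rewrite BE leq_addr.
    by rewrite -{1}(expn1 `|B|) leq_pexp2l // odd_gt0.
  rewrite /bs mem_cat; case: (leP 0 B) => B0; [apply/orP; left|apply/orP; right];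
    apply/mapP; exists `|B|%N => //; lia.
rewrite -[X in (_ <= _ * X)%N]big_filter -/us big_cat !big_map /=.
rewrite [X in (_ + X)%N](eq_bigr (fun u : nat => tau ((n - u ^ 2) %/ 4)));
  last first.
  by move=> u _; rewrite abszN.
rewrite addnn -mul2n leq_mul2l /=; apply: eq_leq.
apply: eq_big_seq => u; rewrite mem_filter => /andP[/andP[ou un] _].
congr tau; move: un; rewrite -natrX ltr_nat => un.
(* The square of an odd u is 1 modulo 4, as is n, so the rounding on both sides is exact. *)
have [k kE] : exists k, n = (u ^ 2 + 4 * k)%N.
  exists ((n - u ^ 2) %/ 4)%N.
  have := divn_eq u 2; rewrite modn2 ou /=.
  move: (u %/ 2)%N => v uE.
  have : (u ^ 2 = 4 * (v ^ 2 + v) + 1)%N by rewrite uE; ring.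
  by move: (u ^ 2)%N (v ^ 2 + v)%N un => U V *; lia.
rewrite kE addKn mulKn //.
have -> : (u ^ 2 + 4 * k)%N%:~R / 4 - (u ^ 2)%:R / 4 = k%:R :> rat.
  by rewrite -pmulrn natrD natrM; field.
by rewrite natrK.
Qed.

(** * Equations of the complete quotients and their conjugates *)

(** The continued fraction algorithm run on equations instead of real numbers, so that each complete
    quotient keeps its conjugate, the root for [- s]. *)
Fixpoint cf_form (a : nat -> int) (g : qform) (n : nat) : qform :=
  if n is k.+1 then qform_inv (qform_shift (a k) (cf_form a g k)) else g.

Section CompleteQuotients.

Variables (R : realType) (d : int) (s : R) (g : qform).
Hypothesis d_nonsquare : forall t : int, t ^+ 2 <> d.
Hypotheses (s_sqr : s ^+ 2 = d%:~R) (disc_g : qform_disc g = d).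

Let y := cf_complete (qform_root s g).
Let a := cf_quotient (qform_root s g).
Let F := cf_form a g.
Let z n := qform_root (- s) (F n).

Lemma cf_form_disc n : qform_disc (F n) = d.
Proof. by elim: n => //= n IH; rewrite qform_disc_inv qform_disc_shift. Qed.

Lemma cf_form_root n : qform_root s (F n) = y n.
Proof.
elim: n => // n IH; have dn := cf_form_disc n.
rewrite /= (qform_root_inv d_nonsquare) ?qform_disc_shift //.
by rewrite (qform_root_shift d_nonsquare) // -/F IH.
Qed.

(** The conjugate follows the same recursion, with the partial quotient of [y n] and not its own
    floor. *)
Lemma cf_form_conjS n : z n.+1 = (z n - (a n)%:~R)^-1.
Proof.
have dn := cf_form_disc n.
rewrite /z /= (qform_root_inv d_nonsquare) ?sqrrN ?qform_disc_shift //.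
by rewrite (qform_root_shift d_nonsquare).
Qed.

Lemma cf_frac_itv n : 0 < y n - (a n)%:~R < 1.
Proof.
have /andP[h1 h2] := floor_itv (y n); rewrite -/(a n) in h1 h2.
have h3 : y n != (a n)%:~R.
  by rewrite -cf_form_root; apply: qform_root_neq_int (cf_form_disc n) _.
rewrite subr_gt0 lt_neqAle eq_sym h3 h1 /=.
by move: h2; rewrite intrD; lra.
Qed.

Lemma cf_completeS n : y n.+1 = (y n - (a n)%:~R)^-1.
Proof. by []. Qed.

Lemma cf_completeS_gt1 n : 1 < y n.+1.
Proof. by have /andP[h1 h2] := cf_frac_itv n; rewrite cf_completeS invf_gt1. Qed.

Lemma cf_quotientS_ge1 n : 1 <= a n.+1.
Proof. by rewrite /a /cf_quotient floor_ge_int (ltW (cf_completeS_gt1 n)). Qed.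

(** Index 0 is excluded because [a 0] may be negative; later partial quotients are at least 1. *)
Lemma cf_form_conj_ltS n : (0 < n)%N -> z n < 0 -> z n.+1 < 0.
Proof.
case: n => // n _ zn; rewrite cf_form_conjS invr_lt0.
have : 1 <= (a n.+1)%:~R :> R by rewrite ler1z cf_quotientS_ge1.
lra.
Qed.

(* While the conjugate stays positive, y z > 1, i.e. |C| > |A|; since C is the
   previous A, |A| decreases strictly. *)
Lemma cf_form_conj_neg : exists2 n, (0 < n)%N & z n < 0.
Proof.
have [//|H] := pselect (exists2 n, (0 < n)%N & z n < 0).
have z0 n : 0 < z n.+1.
  rewrite lt_neqAle eq_sym
    (qform_root_neq_int d_nonsquare _ (cf_form_disc _) 0) ?sqrrN //=.
  by rewrite leNgt; apply/negP => zn; apply: H; exists n.+1.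
(* The next conjugate is positive only if this one exceeds its partial quotient, which is at least
   1. *)
have z1 n : 1 < z n.+1.
  have := z0 n.+1; rewrite cf_form_conjS invr_gt0 subr_gt0.
  by apply: le_lt_trans; rewrite ler1z cf_quotientS_ge1.
have A0 n : (F n).1.1 != 0 by apply: qform_lead_neq0 (cf_form_disc n).
have dec n : (`|(F n.+1).1.1| < `|(F n).1.1|)%N.
  have : 1 < y n.+1 * z n.+1.
    by have := cf_completeS_gt1 n; have := z1 n; nra.
  rewrite -cf_form_root (qform_root_mul d_nonsquare) // ?cf_form_disc //.
  move=> /(lt_le_trans)/(_ (ler_norm _)); rewrite normrN normrM normfV.
  rewrite ltr_pdivlMr ?normr_gt0 ?intr_eq0 // mul1r -!intr_norm ltr_int.
  by rewrite (_ : (F n.+1).2 = (F n).1.1) //; lia.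
have bnd n : (`|(F n).1.1| + n <= `|(F 0).1.1|)%N.
  by elim: n => [|n IH]; [lia | have := dec n; lia].
by have := bnd (`|(F 0).1.1|).+1; lia.
Qed.

Lemma cf_form_conj_ev : exists2 N, (0 < N)%N & forall n, (N <= n)%N -> z n < 0.
Proof.
have [N N0 zN] := cf_form_conj_neg; exists N => // n /subnK <-.
elim: (n - N)%N => // k IH; rewrite addSn; apply: cf_form_conj_ltS IH; lia.
Qed.

(** * Distinct equations collected over one period *)

Variables (N T : nat).
Hypotheses (N_gt0 : (0 < N)%N) (z_lt0 : forall n, (N <= n)%N -> z n < 0).
Hypothesis T_min : forall m' T', periodic_after a m' T' -> (T <= T')%N.

(** The equations of the numbers [y n - j], 0 <= j < [a n]. The absolute value only casts to [nat],
    as [a n] is positive from [N] on. *)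
Definition cycle_forms : seq qform :=
  [seq qform_shift j%:Z (F n) | n <- index_iota N (N + T), j <- iota 0 `|a n|].

Lemma cycle_formsP h : h \in cycle_forms ->
  exists n (j : nat), [/\ (N <= n < N + T)%N, (j < `|a n|)%N, h = qform_shift j (F n),
    qform_root s h = y n - j%:R & 1 < qform_root s h].
Proof.
move=> /allpairsPdep[n [j [hn hj ->]]]; exists n, j.
move: hn hj; rewrite mem_index_iota mem_iota add0n => hn /andP[_ hj]; split=> //.
  by rewrite (qform_root_shift d_nonsquare) ?cf_form_disc // cf_form_root -pmulrn.
rewrite (qform_root_shift d_nonsquare) ?cf_form_disc // cf_form_root.
have /andP[h1 _] := cf_frac_itv n.
case: n hn hj h1 => [|n] hn hj h1; first by lia.
(* With [y n > a n], this puts [y n - j] above 1. *)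
have : (j%:Z + 1)%:~R <= (a n.+1)%:~R :> R.
  by rewrite ler_int; have := cf_quotientS_ge1 n; lia.
rewrite intrD; lra.
Qed.

Lemma cycle_forms_disc h : h \in cycle_forms -> qform_disc h = d.
Proof.
by move=> /cycle_formsP[n [j [_ _ -> _ _]]]; rewrite qform_disc_shift cf_form_disc.
Qed.

Lemma cycle_forms_pos h : 0 < s -> h \in cycle_forms -> qform_pos h.
Proof.
move=> s_gt0 hc; have dh := cycle_forms_disc hc.
have [n [j [hn hj hE _ h1]]] := cycle_formsP hc.
apply: (qform_posP d_nonsquare s_gt0 s_sqr dh); first by lra.
rewrite hE (qform_root_shift d_nonsquare) ?cf_form_disc // -/(z n).
have : z n < 0 by apply: z_lt0; lia.
have : 0 <= j%:Z%:~R :> R by rewrite ler0z.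
lra.
Qed.

(* Equal values have equal fractional parts, hence the same next complete
   quotient, so a shorter period would appear. *)
Lemma cf_complete_shift_inj n k (i j : nat) :
  (N <= n < N + T)%N -> (N <= k < N + T)%N ->
  y n - i%:R = y k - j%:R -> n = k /\ i = j.
Proof.
move=> hn hk E.
have frac : y n.+1 = y k.+1.
  (* [y n] and [y k] differ by the integer i - j, hence so do their floors. *)
  have fE : a n = a k + i%:Z - j%:Z.
    apply: floor_def; have /andP[h1 h2] := cf_frac_itv k.
    rewrite -/(y n) !intrD rmorphN /= -!pmulrn; lra.
  rewrite (cf_completeS n) (cf_completeS k) fE !intrD rmorphN /= -!pmulrn.
  congr (_^-1); lra.
have tail l : y (n.+1 + l)%N = y (k.+1 + l)%N.
  elim: l => [|l IH]; first by rewrite !addn0.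
  rewrite !addnS (cf_completeS (n.+1 + l)) (cf_completeS (k.+1 + l)) IH.
  by rewrite /a /cf_quotient -/y IH.
(* Equal tails after u and v make v - u a period, but two indices of the window differ by less than
   [T]. *)
have per u v : (u < v)%N -> (forall l, y (u.+1 + l)%N = y (v.+1 + l)%N) ->
    (T <= v - u)%N.
  move=> uv huv; apply: (T_min (m' := u)); split; first by lia.
  move=> l lu; rewrite /a /cf_quotient -/(y _) -/(y _).
  rewrite -[l in RHS](subnKC lu) huv; congr (Num.floor (y _)); lia.
have nk : n = k.
  case: (ltngtP n k) => // hnk.
    by have := per _ _ hnk tail; lia.
  by have := per _ _ hnk (fun l => esym (tail l)); lia.
split=> //; move: E; rewrite nk => /addrI/oppr_inj/eqP.
by rewrite eqr_nat => /eqP.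
Qed.

Lemma cycle_forms_uniq : uniq cycle_forms.
Proof.
apply: allpairs_uniq_dep => [|n _|]; rewrite ?iota_uniq //.
move=> [n i] [k j] /allpairsPdep[n' [i' [hn hi [-> ->]]]].
move=> /allpairsPdep[k' [j' [hk hj [-> ->]]]] /= E.
rewrite !mem_index_iota in hn hk.
have /(congr1 (qform_root s)) := E.
rewrite !(qform_root_shift d_nonsquare) ?cf_form_disc // !cf_form_root -!pmulrn.
by move=> /(cf_complete_shift_inj hn hk)[-> ->].
Qed.

Lemma size_cycle_forms :
  (size cycle_forms)%:Z = \sum_(N <= n < N + T) a n.
Proof.
rewrite size_allpairs_dep sumnE big_map (big_morph Posz PoszD (erefl _)).
apply: eq_big_nat => -[|n] hn; first by lia.
by rewrite size_iota; have := cf_quotientS_ge1 n; lia.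
Qed.

(** The two lists are disjoint: roots exceed 1 in the first and lie below 1 in the second. *)
Lemma cycle_forms_inv_uniq :
  uniq (cycle_forms ++ [seq qform_inv h | h <- cycle_forms]).
Proof.
rewrite cat_uniq map_inj_uniq ?cycle_forms_uniq //=; last exact: inv_inj qform_invK.
rewrite andbT; apply/hasPn => _ /mapP[h hc ->]; apply/negP => hi.
have [n [j [_ _ _ _ h1]]] := cycle_formsP hc.
have [k [l [_ _ _ _]]] := cycle_formsP hi.
rewrite (qform_root_inv d_nonsquare s_sqr) ?cycle_forms_disc // invf_gt1; lra.
Qed.

End CompleteQuotients.

(** * The given equation and the bound on its period sum *)

Lemma discr_ge0 (R : realType) (r p q : int) (x : R) :
  r%:~R * x ^+ 2 + p%:~R * x = q%:~R -> 0 <= discr r p q.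
Proof.
move=> xroot; rewrite -(ler0z R).
have -> : (discr r p q)%:~R = (2 * r%:~R * x + p%:~R) ^+ 2 :> R.
  by rewrite /discr rmorphD rmorphXn !rmorphM /= -xroot; ring.
exact: sqr_ge0.
Qed.

(** If the discriminant were t^2, then (t - p)/(2r) would be a rational root. *)
Lemma discr_nonsquare (R : realType) (r p q : int) : r <> 0 ->
  has_irrational_roots R r p q -> forall t : int, t ^+ 2 <> discr r p q.
Proof.
move=> /eqP r0 [_ irr] t td.
have r0' : r%:~R != 0 :> R by rewrite intr_eq0.
apply: (irr ((t - p)%:~R / (2 * r)%:~R)).
  move/(congr1 (fun k : int => k%:~R : R)): td.
  rewrite /discr !intrD !rmorphXn !rmorphM /= => td.
  apply: (@mulfI _ (4 * r%:~R)); first by rewrite mulf_neq0 ?pnatr_eq0.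
  transitivity (t%:~R ^+ 2 - p%:~R ^+ 2 : R); first by field.
  by rewrite td; ring.
by exists ((t - p)%:~R / (2 * r)%:~R) => //; rewrite fmorph_div /= !ratr_int.
Qed.

(** Moves the summation window by whole periods, to where the conjugates are negative. *)
Lemma sum_period_shift (a : nat -> int) (m T k : nat) : periodic_after a m T ->
  \sum_(1 <= i < T.+1) a (m + i)%N =
  \sum_((m + k * T).+1 <= n < (m + k * T).+1 + T) a n.
Proof.
move=> [T0 per].
have perk n : (m < n)%N -> a (n + k * T)%N = a n.
  move=> mn; elim: k => [|k IH]; first by rewrite addn0.
  by rewrite mulSnr addnA per ?IH //; lia.
rewrite -{1}[(m + k * T).+1]addn1 addnC big_addn.
rewrite (_ : (_ + T - _)%N = T.+1); last by lia.
apply: eq_big_nat => i /andP[i1 _]; rewrite -(perk (m + i)%N); last by lia.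
by congr a; lia.
Qed.

Theorem theorem2 (R : realType) (r p q : int) (m T : nat)
  (r_neq0 : r <> 0) (roots_irr : has_irrational_roots R r p q) :
  let x : R := (- p%:~R + Num.sqrt (discr r p q)%:~R) / (2 * r%:~R) in
  let a : nat -> int := cf_quotient x in
  let Q : rat := (discr r p q)%:~R / 4 in
  let S : int := \sum_(1 <= i < T.+1) a (m + i)%N in
  is_period_length a T -> periodic_after a m T ->
  S%:~R <= (f Q)%:R :> rat /\
  (odd T -> S%:~R <= 2^-1 * (f Q)%:R :> rat).
Proof.
set d := discr r p q; move=> x a Q S [_ Tmin] per.
have d_ge0 : 0 <= d by case: roots_irr => -[x0 hx] _; apply: discr_ge0 hx.
have d_ns : forall t : int, t ^+ 2 <> d by apply: (discr_nonsquare r_neq0 roots_irr).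
have d_gt0 : 0 < d.
  by rewrite lt_neqAle d_ge0 andbT; apply/eqP => d0; apply: (d_ns 0); rewrite -d0 expr0n.
pose s : R := Num.sqrt d%:~R.
have s_gt0 : 0 < s by rewrite sqrtr_gt0 ltr0z.
have s_sqr : s ^+ 2 = d%:~R by rewrite sqr_sqrtr // ler0z.
pose g : qform := (r, p, q).
have xE : qform_root s g = x by rewrite /qform_root addrC.
have dg : qform_disc g = d by [].
have [N N_gt0 z_lt0] := cf_form_conj_ev d_ns s_sqr dg.
(* Since [T] is at least 1, [N] periods beyond [m] suffice to pass [N]. *)
pose M := (m + N * T).+1.
have T_gt0 : (0 < T)%N by case: per.
have NM : (N <= M)%N by rewrite /M; nia.
have z_lt0M n : (M <= n)%N ->
    qform_root (- s) (cf_form (cf_quotient (qform_root s g)) g n) < 0.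
  by move=> Mn; apply: z_lt0; lia.
have M_gt0 : (0 < M)%N by [].
pose L := cycle_forms s g M T.
have LS : (size L)%:Z = S.
  by rewrite /L (size_cycle_forms d_ns s_sqr dg) // xE /S (sum_period_shift N per).
have uL : uniq (L ++ [seq qform_inv h | h <- L]).
  by apply: (cycle_forms_inv_uniq d_ns) => //; rewrite xE.
have [n dn] : exists n : nat, d = n%:Z by exists `|d|%N; lia.
have := size_qform_pos_le_f (n := n) uL.
rewrite size_cat size_map -/L -dn -/Q => SQ.
have {}SQ : (size L + size L <= f Q)%N.
  apply: SQ; last by exists p, r, q.
  move=> h; rewrite mem_cat => /orP[hL|/mapP[h' hL ->]].
    by split; [apply: (cycle_forms_pos d_ns s_sqr) hL | apply: (cycle_forms_disc d_ns) hL].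
  rewrite qform_inv_pos qform_disc_inv.
  by split; [apply: (cycle_forms_pos d_ns s_sqr) hL | apply: (cycle_forms_disc d_ns) hL].
have {}SQ : S%:~R + S%:~R <= (f Q)%:R :> rat by rewrite -LS -!pmulrn -natrD ler_nat.
have S_ge0 : 0 <= S%:~R :> rat by rewrite -LS ler0z.
(* Both bounds follow from 2S <= f(Q), the first by S >= 0. *)
by split=> [|_]; lra.
Qed.
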